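(* Let $k\ge5$, $m\ge0$, $d\ge0$ be integers with $d$ divisible by $4$. If $$m\ge \min\left\{\left\lceil \frac{(k+2)(k-3)}{2k}\right\rceil,\ \left\lceil \sqrt{2k+\tfrac14}-\tfrac32\right\rceil\right\}-1,$$ then $d_{so}(N,k)=m2^{k-1}+d+2$ for every integer $N$ with $m(2^k-1)+g(k,d+2)+1\le N\le m(2^k-1)+g(k,d+4)-1$.
   Context: $g(k,d)=\sum_{i=0}^{k-1}\lceil d/2^i\rceil$. $d_{so}(n,k)$ denotes the largest minimum distance among all binary self-orthogonal $[n,k]$ codes (a code $C$ is self-orthogonal if $C\subseteq C^\perp$). *)

(* Defs.v *)
From HB Require Import structures.
From mathcomp Require Import all_boot all_order all_algebra.
From mathcomp Require Import Rstruct.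
From Stdlib Require Rdefinitions.
Set Implicit Arguments. Unset Strict Implicit. Unset Printing Implicit Defensive.
Import Order.TTheory GRing.Theory Num.Theory.

Definition wt (n : nat) (v : 'rV['F_2]_n) : nat := #|[set i | v ord0 i != 0%R]|.

(* A binary linear code of length n is represented by a matrix C whose row
   space is the code; C : 'M_(k,n) with \rank C = k is an [n,k] code. *)

Definition dual_code (m n : nat) (C : 'M['F_2]_(m, n)) : 'M['F_2]_n := kermx C^T.

Definition self_orthogonal (m n : nat) (C : 'M['F_2]_(m, n)) : bool :=
  (C <= dual_code C)%MS.

(* minimum distance = minimum weight of a nonzero codeword
   (default n is only reached for the zero code) *)
Definition min_dist (m n : nat) (C : 'M['F_2]_(m, n)) : nat :=
  \big[minn/n]_(v : 'rV['F_2]_n | (v <= C)%MS && (v != 0%R)) wt v.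

Definition d_so (n k : nat) : nat :=
  \max_(C : 'M['F_2]_(k, n) | (\rank C == k) && self_orthogonal C) min_dist C.

Definition g (k d : nat) : nat := \sum_(i < k) ((d + 2 ^ i - 1) %/ 2 ^ i).

(* Main.v *)
Require Import Defs.
From HB Require Import structures.
From mathcomp Require Import all_boot all_order all_algebra.
From mathcomp Require Import all_fingroup all_solvable all_field.
From mathcomp Require Import Rstruct zify lra.
From Stdlib Require Rdefinitions.
Set Implicit Arguments. Unset Strict Implicit. Unset Printing Implicit Defensive.
Import Order.TTheory GRing.Theory Num.Theory.

(** Upper bound: a self-orthogonal code has even weights, so a minimum distance
    above [D - 2], where [D := m 2^(k-1) + d + 4], is at least [D], and the
    Griesmer bound gives [N >= g k D = m (2^k - 1) + g k (d + 4)].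

    Lower bound: reduce to [d + 4 <= 2^(k-1)], put [s := m + 1] and write
    [s 2^(k-1) - D] in binary.  Take as columns [s] copies of every nonzero
    point of [F_2^k] and remove, for each binary digit [2^b], the nonzero points
    of a subspace of dimension [b + 1] (Belov, Solomon-Stiffler).  View [F_2^k] as
    the polynomials of degree less than [k] and let that subspace consist of the
    multiples of an irreducible polynomial of degree [k - 1 - b].  A nonzero point
    lies in at most [s] of these subspaces, because [s + 1] distinct degrees add
    up to at least [1 + ... + (s + 1) >= k]; this last inequality is what the
    hypothesis on [m] says.  The resulting [g k D, k, D] code is doubly even,
    hence self-orthogonal.  As [m >= 1] its length exceeds the number of points,
    so some column is repeated; deleting two equal columns preserves
    self-orthogonality and lowers weights by at most 2.  Finally pad with zeros. *)

(** * Ceilings and the Griesmer sum [g] *)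

Definition cdiv (d q : nat) := (d + q - 1) %/ q.

Lemma cdiv1 d : cdiv d 1 = d.
Proof. by rewrite /cdiv addnK divn1. Qed.

Lemma gE k d : g k d = \sum_(i < k) cdiv d (2 ^ i).
Proof. by []. Qed.

Lemma cdiv_mulDl q a d : 0 < q -> cdiv (a * q + d) q = a + cdiv d q.
Proof. by move=> q0; rewrite /cdiv -!addnBA; [rewrite -addnA divnMDl|lia..]. Qed.

Lemma cdiv_cdiv a b d : 0 < a -> 0 < b -> cdiv (cdiv d a) b = cdiv d (a * b).
Proof.
move=> a0 b0; rewrite /cdiv -addnBA // addnC -divnMDl // -divnMA.
by congr (_ %/ _); nia.
Qed.

(** Nested ceilings compose. The recursion matches one residual-code step of the Griesmer bound. *)
Lemma gS k d : g k.+1 d = d + g k (cdiv d 2).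
Proof.
rewrite /g big_ord_recl /= expn0 -/(cdiv d 1) cdiv1; congr addn.
apply: eq_bigr => i _; rewrite -[RHS]/(cdiv (cdiv d 2) (2 ^ i)).
by rewrite cdiv_cdiv ?expn_gt0 // -expnS.
Qed.

Lemma g_mulDl k m d : g k (m * 2 ^ k.-1 + d) = m * (2 ^ k - 1) + g k d.
Proof.
case: k => [|k] /=; first by rewrite /g !big_ord0; lia.
elim: k d => [|k IHk] d.
  by rewrite /g !big_ord1 -/(cdiv _ 1) -/(cdiv d 1) !cdiv1; lia.
rewrite (gS k.+1 d) gS expnS mulnCA mulnC cdiv_mulDl // IHk !expnS.
by have := expn_gt0 2 k; nia.
Qed.

(** For [d = 4a] the first summand grows by 2, the second by 1, and from the third on the ceilings
    agree. Hence a code of length [g k (d + 4) - 2] still fits the shortest length claimed. *)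
Lemma g_dvd4D4 k d : 4 %| d -> g k (d + 4) <= g k (d + 2) + 3.
Proof.
case/dvdnP=> a ->{d}; case: k => [|[|k]].
- by rewrite /g !big_ord0.
- by rewrite /g !big_ord1 -!/(cdiv _ 1) !cdiv1; lia.
rewrite !gS !cdiv_cdiv //; set u := cdiv _ (2 * 2).
suff [-> ->] : u = cdiv (a * 4 + 2) (2 * 2) /\
  cdiv (a * 4 + 4) 2 = (cdiv (a * 4 + 2) 2).+1 by lia.
by split; rewrite /u /cdiv; lia.
Qed.

(** * Binary digits and the length of the construction *)

Definition bit E b := odd (E %/ 2 ^ b).

Lemma sum_bits n E : E < 2 ^ n -> \sum_(b < n) bit E b * 2 ^ b = E.
Proof.
elim: n E => [|n IHn] E; first by rewrite big_ord0; lia.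
rewrite expnS => lt_E; rewrite big_ord_recl /bit /= expn0 divn1 muln1.
have /IHn : E %/ 2 < 2 ^ n by lia.
set S := \sum_(b < n) _ => SE; rewrite (_ : bigop _ _ _ = 2 * S); first lia.
rewrite big_distrr /=; apply: eq_bigr => i _.
by rewrite /bit /bump /= add1n expnS divnMA mulnCA.
Qed.

(** A digit at place [b] contributes [2 ^ b + ... + 2 + 1] to the floors, the number of nonzero
    points of the subspace removed for it. *)
Lemma sum_half_bits n E : E < 2 ^ n ->
  \sum_(i < n) E %/ 2 ^ i = \sum_(b < n) bit E b * (2 ^ b.+1 - 1).
Proof.
elim: n E => [|n IHn] E; first by rewrite !big_ord0.
move=> lt_E; have lt_E2 : E %/ 2 < 2 ^ n by move: lt_E; rewrite expnS; lia.
rewrite !big_ord_recl /= expn0 divn1 expn1 muln1.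
rewrite (eq_bigr (fun i : 'I_n => E %/ 2 %/ 2 ^ i)); last first.
  by move=> i _; rewrite /bump /= add1n expnS divnMA.
rewrite IHn //; have := sum_bits lt_E2 => SE.
have -> : \sum_(i < n) bit E (bump 0 i) * (2 ^ (bump 0 i).+1 - 1) =
   \sum_(b < n) bit (E %/ 2) b * (2 ^ b.+1 - 1) + 2 * \sum_(b < n) bit (E %/ 2) b * 2 ^ b.
  rewrite big_distrr -big_split /=; apply: eq_bigr => i _.
  rewrite /bump /= add1n /bit (expnS 2 i) divnMA (expnS 2 i.+1) (expnS 2 i).
  have := expn_gt0 2 i; nia.
by rewrite SE /bit divn1; lia.
Qed.

(** As [2 ^ i] divides [s * 2 ^ n], the ceiling of the difference is [s * 2 ^ (n - i)] minus the
    floor of [E / 2 ^ i]. *)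
Lemma g_sub n s E : 0 < s -> E <= 2 ^ n ->
  g n.+1 (s * 2 ^ n - E) + \sum_(i < n.+1) E %/ 2 ^ i = s * (2 ^ n.+1 - 1).
Proof.
move=> s0 le_E.
rewrite gE -big_split /= (eq_bigr (fun i : 'I_n.+1 => s * 2 ^ (n - i))); last first.
  move=> i _; have le_in : i <= n by rewrite -ltnS.
  have -> : s * 2 ^ n = s * 2 ^ (n - i) * 2 ^ i by rewrite -mulnA -expnD subnK.
  have lE : E <= s * 2 ^ (n - i) * 2 ^ i by rewrite -mulnA -expnD subnK //; nia.
  rewrite /cdiv; move: lE; set A := s * _; set q := 2 ^ i => lE.
  have q0 : 0 < q by rewrite expn_gt0.
  rewrite {1}(divn_eq E q); move: (ltn_pmod E q0) (divn_eq E q).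
  set a := E %/ q; set r := E %% q => rq Ea.
  have le_aA : a <= A by nia.
  have -> : A * q - (a * q + r) + q - 1 = (A - a) * q + (q - 1 - r).
    have : a * q + r <= A * q by lia.
    nia.
  rewrite divnMDl // divn_small; lia.
rewrite -big_distrr /=; congr muln.
rewrite (reindex_inj rev_ord_inj) /= subn1 predn_exp mul1n.
by apply: eq_bigr => i _; congr (2 ^ _); have := ltn_ord i; lia.
Qed.

(** * Weights over F_2 and the Griesmer bound *)

Lemma F2_eq_neq0 (a : 'F_2) : a = (a != 0%R)%:R%R.
Proof. by apply/val_inj; case: a => [[|[|]]]. Qed.

Lemma F2_neq0D (a b : 'F_2) : (a + b != 0)%R = (a != 0%R) (+) (b != 0%R).
Proof. by case: a b => [[|[|]]] // ? [[|[|]]]. Qed.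

Lemma F2_nat_eq0 n : (n%:R == 0 :> 'F_2)%R = ~~ odd n.
Proof. by rewrite -(dvdn_pcharf (pchar_Fp (isT : prime 2))) dvdn2. Qed.

Lemma F2_sum (I : finType) (F : I -> 'F_2) :
  (\sum_i F i)%R = (\sum_i (F i != 0%R))%:R%R.
Proof. by rewrite natr_sum; apply: eq_bigr => i _; apply: F2_eq_neq0. Qed.

Lemma wtE n (v : 'rV['F_2]_n) : wt v = \sum_j (v ord0 j != 0%R).
Proof. by rewrite /wt cardsE -sum1_card big_mkcond. Qed.

(** Induction by residual codes: take [u] of least weight and keep only the positions where [u *m A]
    vanishes. The set [J] records the positions kept, so [n] stays fixed. *)
Lemma griesmer k n (A : 'M['F_2]_(k, n)) (J : {pred 'I_n}) d :
  (forall u : 'rV_k, u != 0%R ->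
     d <= \sum_(j in J) ((u *m A)%R ord0 j != 0%R)) ->
  g k d <= #|J|.
Proof.
elim: k n A J d => [|k IHk] n A J d min_d; first by rewrite /g big_ord0.
pose w (u : 'rV_k.+1) := \sum_(j in J) ((u *m A)%R ord0 j != 0%R).
have e0 : (delta_mx 0 0 : 'rV['F_2]_k.+1)%R != 0%R.
  by apply/eqP => /matrixP/(_ 0 0)%R; rewrite !mxE.
pose u := [arg min_(u < (delta_mx 0 0)%R | u != 0%R) w u].
have [u_neq0 u_min] : u != 0%R /\ forall v, v != 0%R -> w u <= w v.
  by rewrite /u; case: arg_minnP.
have [i ui] : exists i, u 0%R i != 0%R by apply/rV0Pn.
(* On the support of [u *m A] exactly one of [v], [v + u] gives a nonzero entry; elsewhere they
   agree. Both weights being at least [w u], the residual weight is at least [w u / 2]. *)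
have w_half v : w v + w (v + u)%R =
    2 * \sum_(j in J | (u *m A)%R ord0 j == 0%R) ((v *m A)%R ord0 j != 0%R) + w u.
  rewrite big_mkcondr /= big_distrr -!big_split /=; apply: eq_bigr => j _.
  rewrite mulmxDl [X in _ + (X != _)]mxE F2_neq0D.
  by case: ((u *m A)%R ord0 j == 0%R); case: ((v *m A)%R ord0 j == 0%R).
have card_J : #|J| = w u + #|[pred j in J | (u *m A)%R ord0 j == 0%R]|.
  rewrite -!sum1_card big_mkcondr /= -big_split /=.
  by apply: eq_bigr => j _; case: eqP.
rewrite gS card_J; apply: leq_add; first exact: min_d.
apply: (IHk n (row' i A)) => v' v'_neq0.
(* As [u] is nonzero at [i], the vectors vanishing at [i] form a complement of the line of [u]. *)
pose v := (v' *m row' i 1%:M)%R.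
have vA : (v *m A = v' *m row' i A)%R.
  by rewrite -mulmxA !row'Esub mul_rowsub_mx mul1mx.
have v_i : v 0%R i = 0%R.
  by rewrite !mxE big1 // => l _; rewrite !mxE eq_sym (negPf (neq_lift i l)) mulr0.
have v_neq0 : v != 0%R.
  have [l v'l] : exists l, v' 0%R l != 0%R by apply/rV0Pn.
  apply/rV0Pn; exists (lift i l); rewrite !mxE (bigD1 l) //= big1 => [|l' ll'].
    by rewrite !mxE eqxx mulr1 addr0.
  by rewrite !mxE (inj_eq lift_inj) (negPf ll') mulr0.
have vu_neq0 : (v + u != 0)%R by apply/rV0Pn; exists i; rewrite mxE v_i add0r.
have := w_half v; have := u_min _ v_neq0; have := u_min _ vu_neq0.
have := min_d _ u_neq0; rewrite -/(w u) vA.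
rewrite /cdiv (eq_bigl [in [pred j in J | (u *m A)%R ord0 j == 0%R]]) //.
lia.
Qed.

(** * Self-orthogonal codes and the upper bound *)

Lemma self_orthogonalP m n (C : 'M['F_2]_(m, n)) :
  reflect (C *m C^T = 0)%R (self_orthogonal C).
Proof. exact: sub_kermxP. Qed.

(** Modulo 2, the weight of a word is its product with itself. *)
Lemma self_orthogonal_even m n (C : 'M['F_2]_(m, n)) (v : 'rV_n) :
  self_orthogonal C -> (v <= C)%MS -> ~~ odd (wt v).
Proof.
move=> /self_orthogonalP CC0 /submxP[u ->]; set w := (u *m C)%R.
have : (w *m w^T = 0)%R.
  by rewrite /w trmx_mul mulmxA -(mulmxA u) CC0 mulmx0 mul0mx.
move=> /matrixP/(_ ord0 ord0); rewrite !mxE => /eqP.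
rewrite F2_sum F2_nat_eq0 wtE.
by under eq_bigr => j _ do rewrite [X in (_ * X)%R]mxE mulf_eq0 orbb.
Qed.

Lemma min_dist_le m n (C : 'M['F_2]_(m, n)) (v : 'rV_n) :
  (v <= C)%MS -> v != 0%R -> min_dist C <= wt v.
Proof.
move=> vC v0; have := mem_index_enum v; rewrite /min_dist.
elim: (index_enum _) => //= w r IHr; rewrite inE big_cons.
case: eqP => [<- _|_ /IHr]; first by rewrite vC v0 geq_minl.
by case: ifP => // _; apply: leq_trans; apply: geq_minr.
Qed.

Lemma leq_min_dist m n (C : 'M['F_2]_(m, n)) e : e <= n ->
  (forall v : 'rV_n, (v <= C)%MS -> v != 0%R -> e <= wt v) -> e <= min_dist C.
Proof.
move=> le_en min_e; rewrite /min_dist; elim/big_ind: _ => // [x y ? ?|v /andP[]].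
  by rewrite leq_min; apply/andP.
exact: min_e.
Qed.

Lemma min_dist_lt m n (C : 'M['F_2]_(m, n)) e :
  \rank C = m -> self_orthogonal C -> ~~ odd e -> n < g m e ->
  min_dist C < e.-1.
Proof.
move=> rkC soC even_e lt_n; rewrite ltnNge; apply/negP => le_e.
move: lt_n; rewrite ltnNge => /negP; apply.
rewrite -[X in _ <= X](card_ord n); apply: (@griesmer _ _ C) => u u_neq0.
have uC_neq0 : (u *m C != 0)%R by rewrite mulmx_free_eq0 // /row_free rkC.
have uC : ((u *m C)%R <= C)%MS by apply: submxMl.
rewrite -wtE; have := self_orthogonal_even soC uC.
have := min_dist_le uC uC_neq0; lia.
Qed.

(** The condition [2 < e] keeps [e.-1] above 0, the value of an empty maximum. *)
Lemma d_so_lt k n e : ~~ odd e -> 2 < e -> n < g k e -> d_so n k < e.-1.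
Proof.
move=> even_e e2 lt_n; rewrite /d_so.
elim/big_ind: _ => [|x y ? ?|C /andP[/eqP rkC soC]]; first lia.
  by rewrite gtn_max; apply/andP.
exact: min_dist_lt.
Qed.

(** * Codes from lists of columns *)

Definition dot k (u p : 'rV['F_2]_k) : 'F_2 := (u *m p^T)%R ord0 ord0.

Lemma dotDl k (u v p : 'rV['F_2]_k) : dot (u + v)%R p = (dot u p + dot v p)%R.
Proof. by rewrite /dot mulmxDl mxE. Qed.

Lemma dotDr k (u p q : 'rV['F_2]_k) : dot u (p + q)%R = (dot u p + dot u q)%R.
Proof. by rewrite /dot linearD mulmxDr mxE. Qed.

Lemma dotr0 k (u : 'rV['F_2]_k) : dot u 0%R = 0%R.
Proof. by rewrite /dot trmx0 mulmx0 mxE. Qed.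

Lemma dot_delta k (i : 'I_k) (p : 'rV['F_2]_k) : dot (delta_mx ord0 i)%R p = p ord0 i.
Proof. by rewrite /dot -rowE !mxE. Qed.

Lemma sum_nth_count (T : Type) (x0 : T) n (s : seq T) (a : pred T) :
  size s = n -> \sum_(j < n) a (nth x0 s j) = count a s.
Proof. by move=> <-; rewrite -sum1_count [RHS]big_mkcond (big_nth x0) big_mkord. Qed.

(** With the list as columns of [C], the weight of [u *m C] counts the columns not orthogonal to
    [u]. Positive weights force full rank; even overlaps of the rows make [C *m C^T] vanish. *)
Lemma leq_d_so_columns k n e (s : seq 'rV['F_2]_k) :
  0 < k -> 0 < e -> size s = n ->
  (forall u : 'rV_k, u != 0%R -> e <= count (fun p => dot u p != 0%R) s) ->
  (forall u v : 'rV_k,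
     ~~ odd (count (fun p => (dot u p != 0%R) && (dot v p != 0%R)) s)) ->
  e <= d_so n k.
Proof.
move=> k0 e0 size_s min_e even_s.
pose C : 'M['F_2]_(k, n) := (\matrix_(i, j) (nth 0 s j) ord0 i)%R.
have uC u j : (u *m C)%R ord0 j = dot u (nth 0%R s j).
  by rewrite /dot !mxE; apply: eq_bigr => i _; rewrite !mxE.
have wtC u : wt (u *m C)%R = count (fun p => dot u p != 0%R) s.
  by rewrite wtE -(sum_nth_count 0%R _ size_s); apply: eq_bigr => j _; rewrite uC.
have rkC : row_free C.
  apply: inj_row_free => u uC0; apply/eqP; apply: contraTT e0 => /min_e.
  rewrite -wtC uC0 wtE big1 => [|j _]; first by rewrite -leqNgt.
  by rewrite mxE eqxx.
have soC : self_orthogonal C.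
  apply/self_orthogonalP/matrixP => i j; rewrite !mxE F2_sum; apply/eqP.
  rewrite F2_nat_eq0; have := even_s (delta_mx ord0 i)%R (delta_mx ord0 j)%R.
  rewrite -(sum_nth_count 0%R _ size_s); congr (~~ odd _); apply: eq_bigr => l _.
  by rewrite !dot_delta !mxE mulf_eq0 negb_or.
have e_rk : e <= min_dist C.
  apply: leq_min_dist => [|v /submxP[u ->] uC0].
    (* Any nonzero vector, here the all-one vector, shows [e <= n], which the default value in
       [min_dist] requires. *)
    rewrite -size_s; apply: leq_trans (min_e (const_mx 1%R) _) (count_size _ _).
    by apply/rV0Pn; exists (Ordinal k0); rewrite mxE.
  by rewrite wtC min_e //; apply: contraNneq uC0 => ->; rewrite mul0mx.
apply: leq_trans e_rk _; rewrite /d_so.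
by apply: (@leq_bigmax_cond _ _ (@min_dist k n) C); rewrite soC andbT.
Qed.

(** * Irreducible polynomials of every degree *)

Section IrreduciblePolynomials.
Local Open Scope ring_scope.

(** Take the minimal polynomial of a generator [z] of the multiplicative group of the field with
    [p ^ n] elements: [z] generates the whole field, so the degree is [n]. *)
Lemma exists_irreducible_poly (p n : nat) : prime p -> (0 < n)%N ->
  exists2 f : {poly 'F_p}, irreducible_poly f & size f = n.+1.
Proof.
move=> p_pr n_gt0; have [F chF cardF] := pPrimePowerField p_pr n_gt0.
pose L := pPrimeCharType chF.
have dimL : \dim {:L} = n.
  by rewrite (pprimeChar_dimf chF) cardF pfactorK.
have /cyclicP[x gen_x] := field_unit_group_cyclic [set: {unit F}].
pose z : L := FinRing.uval x.
have adj_z : <<1; z>>%VS = {:L}%VS.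
  apply/eqP; rewrite eqEsubv subvf /=; apply/subvP=> y _.
  have [->|y_neq0] := eqVneq y 0; first exact: mem0v.
  have : finField_unit y_neq0 \in <[x]>%g by rewrite -gen_x inE.
  case/cycleP=> i /(congr1 FinRing.uval) yE.
  have -> : y = z ^+ i.
    by rewrite -[y]/(FinRing.uval (finField_unit y_neq0)) yE FinRing.val_unitX.
  exact/rpredX/memv_adjoin.
have /polyOver1P[f fE] := minPolyOver 1%AS z.
have size_f : size f = n.+1.
  have -> : size f = size (minPoly 1%AS z) by rewrite fE size_map_poly.
  rewrite size_minPoly -dimL -adj_z dim_Fadjoin dimv1 muln1 //.
exists f => //; split; first by rewrite size_f ltnS.
move=> q size_q q_dvd_f.
have := @minPoly_irr _ _ 1%AS z (map_poly (in_alg L) q) _ _.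
rewrite fE dvdp_map eqp_map => /(_ _ q_dvd_f) /orP[| // |].
  by apply/polyOver1P; exists q.
by rewrite -(rmorph1 (map_poly (in_alg L))) eqp_map -size_poly_eq1
  (negPf size_q).
Qed.

End IrreduciblePolynomials.

(** * Hyperplane sections and subspaces of multiples *)

Lemma card_hyperplane_compl k (U : {set 'rV['F_2]_k}) u :
  {in U &, forall p q, (p + q)%R \in U} ->
  #|[set p in U | dot u p != 0%R]| = 0 \/
  2 * #|[set p in U | dot u p != 0%R]| = #|U|.
Proof.
move=> addU; set V := [set p in U | _].
case: (set_0Vmem V) => [-> | [q]]; first by left; rewrite cards0.
rewrite inE => /andP[Uq uq]; right.
have pqq (p : 'rV['F_2]_k) : (p + q + q = p)%R.
  apply/rowP => i; rewrite !mxE; apply/eqP.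
  by case: (p _ _) (q _ _) => [[|[|]]] // ? [[|[|]]].
rewrite -(cardsID [set p | dot u p != 0%R] U) -setIdE mul2n -addnn; congr addn.
(* Translation by [q] exchanges the two parts of [U] cut out by [u]. *)
have -> : U :\: [set p | dot u p != 0%R] = [set (p + q)%R | p in V].
  apply/setP => p; rewrite !inE negbK; apply/andP/imsetP => [[up Up] | [p']].
    exists (p + q)%R; last by rewrite pqq.
    by rewrite inE addU //= dotDr (eqP up) add0r.
  rewrite inE => /andP[Up' up'] ->; split; last exact: addU.
  by rewrite -[_ == _]negbK dotDr F2_neq0D up' uq.
by rewrite card_imset // => p p' /(congr1 (fun x => x + q)%R); rewrite !pqq.
Qed.

Lemma card_rV_F2 k : #|'rV['F_2]_k| = 2 ^ k.
Proof. by rewrite card_mx card_Fp // mul1n. Qed.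

Lemma card_nonorthogonal n (u : 'rV['F_2]_n.+1) : u != 0%R ->
  #|[set p | dot u p != 0%R]| = 2 ^ n.
Proof.
move=> /rV0Pn[i ui].
have := @card_hyperplane_compl _ [set: 'rV['F_2]_n.+1] u (fun p q _ _ => in_setT _).
rewrite setIdE setTI cardsT card_rV_F2 expnS => -[/eqP|/eqP]; last first.
  by rewrite eqn_pmul2l // => /eqP.
rewrite cards_eq0 => /eqP/setP/(_ (delta_mx ord0 i)%R).
by rewrite !inE /dot trmx_delta -colE mxE ui.
Qed.

(** Row vectors stand for polynomials of degree below [k]; for [f] of degree [c <= k] this is a
    subspace of dimension [k - c]. *)
Definition multiples k (f : {poly 'F_2}) : {set 'rV['F_2]_k} :=
  [set p | (f %| rVpoly p)%R].

Lemma multiples_add k f : {in multiples k f &, forall p q, (p + q)%R \in multiples k f}.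
Proof. by move=> p q; rewrite !inE linearD /=; apply: dvdp_add. Qed.

Lemma card_multiples c e (f : {poly 'F_2}) :
  size f = c.+1 -> #|multiples (c + e) f| = 2 ^ e.
Proof.
move=> size_f; have f0 : f != 0%R by rewrite -size_poly_eq0 size_f.
pose mulf (q : 'rV['F_2]_e) : 'rV_(c + e) := poly_rV (f * rVpoly q)%R.
have mulfK (q : 'rV['F_2]_e) : rVpoly (mulf q) = (f * rVpoly q)%R.
  rewrite poly_rV_K //; apply: leq_trans (size_polyMleq _ _) _.
  by rewrite size_f addSn leq_add2l size_poly.
have -> : multiples (c + e) f = [set mulf q | q : 'rV_e].
  apply/setP => p; rewrite inE; apply/idP/imsetP => [/dvdpP[q pE]|[q _ ->]]; last first.
    by rewrite mulfK dvdp_mulr.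
  exists (poly_rV q) => //; apply: (can_inj rVpolyK); rewrite mulfK poly_rV_K.
    by rewrite pE mulrC.
  have [->|q0] := eqVneq q 0%R; first by rewrite size_poly0.
  have : size (rVpoly p) <= c + e by apply: size_poly.
  by rewrite pE size_mul // size_f addnS /= addnC leq_add2l.
rewrite card_imset ?card_rV_F2 // => q q' /(congr1 rVpoly).
by rewrite !mulfK => /(mulfI f0)/(can_inj rVpolyK).
Qed.

(** * Coprime families and their common multiples *)

Lemma exists_irreducible_family (p n : nat) : prime p ->
  exists F : nat -> {poly 'F_p}, forall i, i < n ->
    irreducible_poly (F i) /\ size (F i) = i.+2.
Proof.
move=> p_pr; elim: n => [|n [F F_irr]]; first by exists (fun=> 0%R).
have [f irr_f size_f] := exists_irreducible_poly p_pr (ltn0Sn n).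
exists (fun i => if i == n then f else F i) => i; rewrite ltnS leq_eqVlt.
by case: eqP => [-> | _ /F_irr].
Qed.

Lemma irreducible_size_coprimep (K : fieldType) (f g : {poly K}) :
  irreducible_poly f -> irreducible_poly g -> size f != size g -> coprimep f g.
Proof.
move=> irr_f irr_g; rewrite irreducible_poly_coprime //; apply: contraNN => f_dvd_g.
by rewrite (eqp_size (apply_irredp irr_g _ f_dvd_g)) // gtn_eqF // irr_f.
Qed.

(** The sum of [c] distinct positive integers is at least [1 + ... + c]. The bound [c <= n] serves
    the induction: a new term [n + 1] is at least [c + 1]. *)
Lemma leq_sum_distinct (P : pred nat) n :
  (\sum_(i < n) P i <= n) /\
  (\sum_(i < n) P i) * (\sum_(i < n) P i).+1 <= 2 * \sum_(i < n) P i * i.+1.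
Proof.
elim: n => [|n [le_n IHn]]; first by rewrite !big_ord0.
rewrite !big_ord_recr /=; move: le_n IHn.
set c := \sum_(i < n) P i; set S := \sum_(i < n) _ * _.
by case: (P n) => /=; split; nia.
Qed.

Section IrreducibleFamily.

Variables (K : fieldType) (F : nat -> {poly K}) (n : nat).
Hypothesis F_irr : forall i, i < n -> irreducible_poly (F i) /\ size (F i) = i.+2.

Lemma size_prod_family (P : pred nat) l : l <= n ->
  size (\prod_(i < l | P i) F i)%R = (\sum_(i < l) P i * i.+1).+1.
Proof.
elim: l => [|l IHl] le_ln; first by rewrite !big_ord0 size_poly1.
rewrite big_mkcond !big_ord_recr -big_mkcond /=; have [_ szF] := F_irr le_ln.
have szP := IHl (ltnW le_ln).
case: (P l); last by rewrite mulr1 szP mul0n addn0.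
by rewrite size_mul -?size_poly_eq0 ?szP ?szF //= mul1n addnS.
Qed.

Lemma prod_family_dvdp (P : pred nat) (p : {poly K}) l : l <= n ->
  (forall i, i < l -> P i -> (F i %| p)%R) -> (\prod_(i < l | P i) F i %| p)%R.
Proof.
elim: l => [|l IHl] le_ln dvd_p; first by rewrite big_ord0 dvd1p.
rewrite big_mkcond big_ord_recr -big_mkcond /=.
have dvd_l : (\prod_(i < l | P i) F i %| p)%R.
  by apply: IHl => [|i il]; [apply: ltnW | apply: dvd_p; apply: ltnW].
case: ifP => Pl; last by rewrite mulr1.
rewrite Gauss_dvdp ?dvd_l ?dvd_p //.
have [irr_l sz_l] := F_irr le_ln.
elim/big_rec: _ => [|i q _ cop]; first exact: coprime1p.
rewrite coprimepMl cop andbT.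
have [irr_i sz_i] := F_irr (ltn_trans (ltn_ord i) le_ln).
by apply: irreducible_size_coprimep => //; rewrite sz_i sz_l !eqSS ltn_eqF.
Qed.

(** Distinct degrees make the members coprime, so the product of those dividing [p] divides [p].
    With [s + 1] of them its degree would be at least [(s + 1)(s + 2) / 2], hence at least
    [size p]. *)
Lemma family_dvdp_bound (p : {poly K}) s : p != 0%R ->
  2 * (size p) <= s.+1 * s.+2 -> \sum_(i < n) (F i %| p)%R <= s.
Proof.
move=> p0 size_p; rewrite leqNgt; apply/negP => lt_s.
pose P i := (F i %| p)%R.
have [_] := leq_sum_distinct P n.
have : (\sum_(i < n) P i * i.+1).+1 <= size p.
  by rewrite -size_prod_family // dvdp_leq // prod_family_dvdp.
move: lt_s; rewrite -[\sum_(i < n) _]/(\sum_(i < n) P i).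
move: (\sum_(i < n) P i) (\sum_(i < n) P i * i.+1) => c S.
by nia.
Qed.

End IrreducibleFamily.

(** * The Belov columns *)

Definition seq_of_mult (T : finType) (M : T -> nat) : seq T :=
  flatten [seq nseq (M x) x | x <- enum T].

Lemma count_seq_of_mult (T : finType) (M : T -> nat) (a : pred T) :
  count a (seq_of_mult M) = \sum_(x | a x) M x.
Proof.
rewrite count_flatten -map_comp sumnE big_map big_enum /= [RHS]big_mkcond /=.
by apply: eq_bigr => x _; rewrite count_nseq; case: (a x); rewrite ?mul1n.
Qed.

Lemma dvd4_exp2 n : 1 < n -> 4 %| 2 ^ n.
Proof. exact: (@dvdn_exp2l 2 2). Qed.

Lemma dvd4_bit E b : 4 %| E -> 4 %| bit E b * 2 ^ b.
Proof.
case/dvdnP => x ->; case: b => [|[|b]]; last by rewrite !expnS; lia.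
  by rewrite /bit expn0 divn1 oddM andbF.
by rewrite /bit expn1 (_ : x * 4 = x * 2 * 2) ?mulnK ?oddM ?andbF //; lia.
Qed.

(** A nonzero point [p] gets multiplicity [s - h p], where [h p] counts the removed subspaces
    containing it. Each digit [2 ^ b] of [E] costs 0 or [2 ^ b] of the [s * 2 ^ n] columns not
    orthogonal to [u], all multiples of 4. *)
Lemma exists_belov_columns n s E :
  1 < n -> 2 * n.+1 <= s.+1 * s.+2 -> E < 2 ^ n -> 4 %| E ->
  exists S : seq 'rV['F_2]_n.+1,
    size S + \sum_(b < n) bit E b * (2 ^ b.+1 - 1) = s * (2 ^ n.+1 - 1) /\
    forall u : 'rV_n.+1, u != 0%R ->
      s * 2 ^ n <= count (fun p => dot u p != 0%R) S + E /\
      4 %| count (fun p => dot u p != 0%R) S.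
Proof.
move=> n1 le_s lt_E dvd_E.
have [F F_irr] := exists_irreducible_family n (isT : prime 2).
(* [rev_ord b] is [n - b - 1], so the polynomial has degree [n - b] and [U b] has dimension
   [b + 1]. *)
pose U (b : 'I_n) := multiples n.+1 (F (rev_ord b)).
have cardU b : #|U b| = 2 ^ b.+1.
  have [_ szF] := F_irr _ (ltn_ord (rev_ord b)).
  have -> : U b = multiples n.+1 (F (rev_ord b)) by [].
  have kE : n.+1 = (n - b.+1).+1 + b.+1 by have := ltn_ord b; lia.
  by rewrite [in LHS]kE (card_multiples _ szF).
pose h p := \sum_(b < n) bit E b * (p \in U b).
have le_h p : p != 0%R -> h p <= s.
  move=> p0; apply: leq_trans (_ : \sum_(i < n) (F i %| rVpoly p)%R <= s).
    rewrite (reindex_inj rev_ord_inj) /=; apply: leq_sum => b _.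
    by rewrite inE; case: bit; rewrite ?mul1n.
  apply: family_dvdp_bound => //.
    by apply: contraNneq p0 => p0; rewrite -[p]rVpolyK p0 linear0.
  apply: leq_trans le_s; rewrite leq_mul2l; exact: size_poly.
(* The point 0 lies in every [U b], so [le_h] does not cover it. *)
pose M p := if p == 0%R then 0 else s - h p.
(* This double count is used twice: on all nonzero points for the length, on points not orthogonal
   to [u] for the weights. *)
have sum_h (a : pred 'rV['F_2]_n.+1) : ~~ a 0%R ->
    \sum_(p | a p) M p + \sum_(b < n) bit E b * #|[set p in U b | a p]| =
    s * #|[set p | a p]|.
  move=> a0; have -> : \sum_(b < n) bit E b * #|[set p in U b | a p]| =
      \sum_(p | a p) h p.
    rewrite exchange_big /=; apply: eq_bigr => b _.
    rewrite -big_distrr /= -sum1_card; congr muln.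
    rewrite big_mkcond [RHS]big_mkcond /=; apply: eq_bigr => p _.
    by rewrite inE; case: (p \in U b); case: (a p).
  rewrite -big_split /= cardsE -sum1_card big_distrr /=; apply: eq_bigr => p ap.
  have p0 : p != 0%R by apply: contraTneq ap => ->.
  by rewrite /M (negPf p0) subnK ?muln1 // le_h.
exists (seq_of_mult M); split.
  rewrite -count_predT count_seq_of_mult (bigD1 0%R) //= {1}/M eqxx add0n.
  have := sum_h [pred p | p != 0%R]; rewrite /= eqxx => /(_ isT).
  have -> : #|[set p : 'rV['F_2]_n.+1 | p != 0%R]| = 2 ^ n.+1 - 1.
    rewrite (_ : [set p | _] = ~: [set 0%R]); last by apply/setP => p; rewrite !inE.
    by rewrite cardsC1 card_rV_F2 subn1.
  move=> <-; congr addn; apply: eq_bigr => b _; congr muln.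
  have -> : [set p in U b | p != 0%R] = U b :\ 0%R.
    by apply/setP => p; rewrite !inE andbC.
  by rewrite -(cardU b) (cardsD1 0%R (U b)) inE linear0 dvdp0 add1n subn1.
move=> u u0; rewrite count_seq_of_mult.
have := sum_h (fun p => dot u p != 0%R); rewrite dotr0 eqxx => /(_ isT).
rewrite card_nonorthogonal // => sumE.
have cU (b : 'I_n) : #|[set p in U b | dot u p != 0%R]| = 0 \/
    #|[set p in U b | dot u p != 0%R]| = 2 ^ b.
  have [->|] := card_hyperplane_compl u (@multiples_add n.+1 (F (rev_ord b))).
    by left.
  by rewrite cardU expnS => /eqP; rewrite eqn_pmul2l // => /eqP ->; right.
split.
  rewrite -sumE leq_add2l -[X in _ <= X](sum_bits lt_E); apply: leq_sum => b _.
  by rewrite leq_mul2l; case: (cU b) => ->; rewrite ?leqnn orbT.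
rewrite -(@dvdn_addl (\sum_(b < n) bit E b * #|[set p in U b | dot u p != 0%R]|)).
  by rewrite sumE dvdn_mull // dvd4_exp2.
apply: dvdn_sum => b _; case: (cU b) => ->; first by rewrite muln0.
exact: dvd4_bit.
Qed.

(** * Doubly even columns and deletion of a pair *)

Lemma doubly_even_pairs k (S : seq 'rV['F_2]_k) :
  (forall u, u != 0%R -> 4 %| count (fun p => dot u p != 0%R) S) ->
  forall u v,
    ~~ odd (count (fun p => (dot u p != 0%R) && (dot v p != 0%R)) S).
Proof.
move=> dvd4 u v.
have {}dvd4 w : 4 %| count (fun p => dot w p != 0%R) S.
  have [->|] := eqVneq w 0%R; last exact: dvd4.
  rewrite (eq_count (a2 := pred0)) ?count_pred0 // => p.
  by rewrite /dot mul0mx mxE eqxx.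
(* Adding two words loses twice their overlap; three weights divisible by 4 make the overlap
   even. *)
have : count (fun p => dot u p != 0%R) S + count (fun p => dot v p != 0%R) S =
    count (fun p => dot (u + v)%R p != 0%R) S +
    2 * count (fun p => (dot u p != 0%R) && (dot v p != 0%R)) S.
  elim: S {dvd4} => //= p S IHS; rewrite dotDl F2_neq0D.
  by case: (dot u p == 0%R); case: (dot v p == 0%R) => /=; lia.
by have := dvd4 u; have := dvd4 v; have := dvd4 (u + v)%R; lia.
Qed.

Lemma not_uniq_perm (T : eqType) (s : seq T) :
  ~~ uniq s -> exists x s', perm_eq s [:: x, x & s'].
Proof.
elim: s => //= y s IHs; rewrite negb_and negbK; case/orP => [ys|/IHs].
  by exists y, (rem y s); rewrite perm_cons perm_to_rem.
case=> x [s' ss']; exists x, (y :: s').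
by apply/seq.permP => a; have /seq.permP/(_ a) := ss'; rewrite /=; lia.
Qed.

Lemma exists_even_columns k m d :
  2 < k -> 0 < m -> 2 * k <= m.+2 * m.+3 -> 4 %| d -> d + 4 <= 2 ^ k.-1 ->
  exists S : seq 'rV['F_2]_k,
    [/\ size S = m * (2 ^ k - 1) + g k (d + 4) - 2,
        forall u, u != 0%R ->
          m * 2 ^ k.-1 + d + 2 <= count (fun p => dot u p != 0%R) S
      & forall u v,
          ~~ odd (count (fun p => (dot u p != 0%R) && (dot v p != 0%R)) S)].
Proof.
case: k => [|n] //= n1 m0 le_k dvd_d le_d.
have pow4 : 4 %| 2 ^ n by apply: dvd4_exp2.
(* This is [m.+1 * 2 ^ n] minus the target weight [m * 2 ^ n + d + 4]. *)
pose E := 2 ^ n - (d + 4).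
have lt_E : E < 2 ^ n by rewrite /E; lia.
have dvd_E : 4 %| E by rewrite /E; lia.
have [S [size_S wt_S]] := @exists_belov_columns n m.+1 E n1 le_k lt_E dvd_E.
have even_S := doubly_even_pairs (fun u u0 => (wt_S u u0).2).
have sizeE : size S = m * (2 ^ n.+1 - 1) + g n.+1 (d + 4).
  have := @g_sub n m.+1 E isT (ltnW lt_E).
  rewrite big_ord_recr /= (divn_small lt_E) addn0 sum_half_bits // -size_S.
  move=> /addIn <-; rewrite -g_mulDl /=; congr g.
  by rewrite /E mulSn; lia.
(* As [m >= 1] and [g n.+1 (d + 4) >= 4], there are more columns than the [2 ^ n.+1] vectors. *)
have : ~~ uniq S.
  apply/negP => /card_uniqP card_S; have := max_card (mem S).
  rewrite card_S sizeE card_rV_F2; have := expn_gt0 2 n.+1.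
  have : 3 < g n.+1 (d + 4) by rewrite gS; lia.
  by nia.
case/not_uniq_perm => p [S' permS].
have countS a : count a S = 2 * a p + count a S'.
  by rewrite (seq.permP permS) /= addnA addnn mul2n.
exists S'; split=> [|u u0|u v].
- by rewrite -sizeE (perm_size permS) /= subn2.
- by have [] := wt_S u u0; rewrite countS /E mulSn; lia.
- by have := even_S u v; rewrite countS oddD oddM.
Qed.

(** * The hypothesis on [m] and the conclusion *)

Lemma columns_bound k m : 4 < k ->
  (Num.min (Num.ceil (((k + 2) * (k - 3))%:R / (2 * k)%:R : Rdefinitions.R))
           (Num.ceil (Num.sqrt (2 * k%:R + 1 / 4 : Rdefinitions.R) - 3 / 2)) - 1
     <= m%:Z)%R ->
  2 * k <= m.+2 * m.+3.
Proof.
move=> k5; rewrite lerBlDr ge_min !ceil_le_int => /orP[].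
  have -> : ((m%:Z + 1)%:~R = m.+1%:R :> Rdefinitions.R)%R.
    by rewrite -natr1 intrD.
  rewrite ler_pdivrMr ?ltr0n; last lia.
  rewrite -natrM ler_nat => le_k.
  (* For [k = 5] the bound needs the integrality of [m]. *)
  have [k5E|k6] : k = 5 \/ 5 < k by lia.
    by rewrite k5E in le_k *; nia.
  (* Here [k = 6] forces [m >= 1], and [k > 6] forces [k <= 2m + 3]. *)
  by nia.
(* Squaring [x <= m + 5/2] gives the claim, as [(m + 5/2)^2 - 1/4 = (m + 2)(m + 3)]. *)
rewrite intrD lerBlDr -[(_%:~R)%R]/(m%:R)%R => le_sqrt.
have := sqr_sqrtr (_ : 0 <= 2 * k%:R + 1 / 4 :> Rdefinitions.R)%R.
have := sqrtr_ge0 (2 * k%:R + 1 / 4 : Rdefinitions.R)%R.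
move: le_sqrt; set x := Num.sqrt _ => le_x x0 x2.
have k0 : (0 <= k%:R :> Rdefinitions.R)%R by [].
have m0 : (0 <= m%:R :> Rdefinitions.R)%R by [].
have {}x2 := x2 ltac:(lra).
rewrite -(ler_nat Rdefinitions.R) !natrM -!natr1.
nra.
Qed.

Theorem theorem5p6 (k m d : nat) :
  5 <= k -> 4 %| d ->
  (Num.min (Num.ceil (((k + 2) * (k - 3))%:R / (2 * k)%:R : Rdefinitions.R))
           (Num.ceil (Num.sqrt (2 * k%:R + 1 / 4 : Rdefinitions.R) - 3 / 2)) - 1
     <= m%:Z)%R ->
  forall N : nat,
    m * (2 ^ k - 1) + g k (d + 2) + 1 <= N <= m * (2 ^ k - 1) + g k (d + 4) - 1 ->
    d_so N k = m * 2 ^ (k - 1) + d + 2.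
Proof.
move=> k5 dvd_d /(columns_bound k5) le_k N; rewrite (subn1 k).
have k0 : 0 < k by lia.
have pow4 : 4 %| 2 ^ k.-1 by apply: dvd4_exp2; lia.
(* Full multiples of [2 ^ k.-1] in [d] move into [m]; enlarging [m] preserves its bound. *)
pose q := d %/ 2 ^ k.-1; pose r := d %% 2 ^ k.-1.
have dE : d = q * 2 ^ k.-1 + r := divn_eq _ _.
have lt_r : r < 2 ^ k.-1 by rewrite ltn_mod expn_gt0.
have dvd_r : 4 %| r by rewrite -(@dvdn_addr (q * 2 ^ k.-1)) -?dE // dvdn_mull.
have gD e : m * (2 ^ k - 1) + g k (d + e) = (m + q) * (2 ^ k - 1) + g k (r + e).
  by rewrite dE -addnA g_mulDl mulnDl addnA.
have -> : m * 2 ^ k.-1 + d + 2 = (m + q) * 2 ^ k.-1 + r + 2.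
  by rewrite {1}dE mulnDl !addnA.
have {}le_k : 2 * k <= (m + q).+2 * (m + q).+3.
  by apply: leq_trans le_k _; rewrite leq_mul ?ltnS ?leq_addr.
rewrite !{}gD; move: (m + q) le_k => {}m le_k; case/andP => geN leN.
have m0 : 0 < m by nia.
have g0 : 3 < g k (r + 4) by rewrite -(prednK k0) gS; lia.
apply/eqP; rewrite eqn_leq; apply/andP; split.
  (* [N] is below the Griesmer length for [D = m * 2 ^ k.-1 + r + 4], so the distance is at most
     [D - 2]. *)
  have := @d_so_lt k N (m * 2 ^ k.-1 + (r + 4)).
  have : 4 %| m * 2 ^ k.-1 by rewrite dvdn_mull.
  rewrite g_mulDl; move: (m * 2 ^ k.-1) (m * (2 ^ k - 1)) leN => x y leN dvd_x.
  move=> /(_ ltac:(lia) ltac:(lia) ltac:(lia)); lia.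
(* Both [r] and [2 ^ k.-1] are multiples of 4, so they differ by at least 4. *)
have le_r : r + 4 <= 2 ^ k.-1 by lia.
have [S [size_S wt_S even_S]] :=
  exists_even_columns (ltnW (ltnW k5)) m0 le_k dvd_r le_r.
have leSN : size S <= N by rewrite size_S; have := g_dvd4D4 k dvd_r; lia.
apply: (@leq_d_so_columns k N _ (S ++ nseq (N - size S) 0%R)) => //.
- by rewrite addn2.
- by rewrite size_cat size_nseq subnKC.
- by move=> u u0; rewrite count_cat; apply: leq_trans (wt_S u u0) (leq_addr _ _).
- by move=> u v; rewrite count_cat count_nseq dotr0 eqxx /= addn0.
Qed.
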